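(* For every positive integer $r$, $r-2 \le \pi^*(S_r) \le \Lambda^*(S_r) \le 2r + \sqrt{(16 \ln 2)r} + 11$.
   Context: For a positive integer $n$, $[n]=\{1,\dots,n\}$ and $\mathcal{B}_n$ denotes the family of all subsets of $[n]$ ordered by inclusion. A poset $P$ is a subposet of $Q$ if $P\subseteq Q$ and $x\le_P y$ iff $x\le_Q y$; a family $\mathcal{F}\subseteq\mathcal{B}_n$ contains a copy of $P$ if some subposet of $(\mathcal{F},\subseteq)$ is isomorphic to $P$, and is $P$-free otherwise. ${\rm La}^*(n,P)$ is the maximum size of a $P$-free family $\mathcal{F}\subseteq\mathcal{B}_n$, and the Turán threshold is $\pi^*(P)=\limsup_{n\to\infty}{\rm La}^*(n,P)/\binom{n}{\lfloor n/2\rfloor}$. The Lubell function of $\mathcal{F}\subseteq\mathcal{B}_n$ is $\ell(\mathcal{F})=\sum_{A\in\mathcal{F}}1/\binom{n}{|A|}$, and $\Lambda^*(P)=\sup\{\ell(\mathcal{F}) : n\ge1,\ \mathcal{F}\subseteq\mathcal{B}_n\ P\text{-free}\}$. The standard example $S_r$ is the poset on $2r$ elements $a_1,\dots,a_r,b_1,\dots,b_r$ in which $\{a_i\}$ and $\{b_j\}$ are antichains and $b_j\le a_i$ iff $i\ne j$ (no other relations). *)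

(* Defs.v *)
From HB Require Import structures.
From mathcomp Require Import all_boot all_order all_algebra.
From mathcomp Require Import all_classical all_reals all_analysis.

Set Implicit Arguments.
Unset Strict Implicit.
Unset Printing Implicit Defensive.

Import Order.TTheory GRing.Theory Num.Theory.
Local Open Scope ring_scope.

Section Posets.
Variables (d : Order.disp_t) (P : finPOrderType d).

(* The subfamily G, ordered by inclusion, is isomorphic to P. *)
Definition poset_iso n (G : {set {set 'I_n}}) : bool :=
  [exists f : {ffun P -> {set 'I_n}},
    [&& injectiveb f, [set f x | x : P] == G &
        [forall x, forall y, (f x \subset f y) == (x <= y)%O]]].

Definition contains_copy n (F : {set {set 'I_n}}) : bool :=
  [exists G : {set {set 'I_n}}, (G \subset F) && poset_iso G].

Definition poset_free n (F : {set {set 'I_n}}) : bool := ~~ contains_copy F.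

Definition La_star (n : nat) : nat :=
  \max_(F : {set {set 'I_n}} | poset_free F) #|F|.

End Posets.

Definition lubell (R : realType) n (F : {set {set 'I_n}}) : R :=
  \sum_(A in F) ('C(n, #|A|)%:R)^-1.

(* The limsup and the supremum are taken in the extended reals, so that no
   boundedness is presupposed. *)
Definition pi_star (R : realType) (d : Order.disp_t) (P : finPOrderType d) :
    \bar R :=
  limn_esup (fun n : nat => ((La_star P n)%:R / 'C(n, n./2)%:R : R)%:E).

Definition Lambda_star (R : realType) (d : Order.disp_t)
    (P : finPOrderType d) : \bar R :=
  ereal_sup [set z : \bar R | exists n (F : {set {set 'I_n}}),
    [/\ (0 < n)%N, poset_free P F & z = (lubell R F)%:E]]%classic.

(* inl i stands for a_i and inr j for b_j. *)
Definition std_example (r : nat) : Type := ('I_r + 'I_r)%type.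

HB.instance Definition _ r := Finite.on (std_example r).

Definition std_le r (x y : std_example r) : bool :=
  match x, y with
  | inl i, inl j => i == j
  | inr i, inr j => i == j
  | inr j, inl i => i != j
  | inl _, inr _ => false
  end.

Fact std_le_refl r : reflexive (@std_le r).
Proof. by case=> i /=. Qed.

Fact std_le_anti r : antisymmetric (@std_le r).
Proof.
by move=> [i|i] [j|j] //=; rewrite ?andbF // => /andP[/eqP->].
Qed.

Fact std_le_trans r : transitive (@std_le r).
Proof.
by move=> [i|i] [j|j] [k|k] //=; do ?[by move/eqP->]; do ?[by move=> + /eqP<-].
Qed.

Fact std_display : Order.disp_t. Proof. exact: (Order.Disp tt tt). Qed.

HB.instance Definition _ r := Order.Le_isPOrder.Build std_display
  (std_example r) (@std_le_refl r) (@std_le_anti r) (@std_le_trans r).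

(* Main.v *)
Require Import Defs.
From mathcomp Require Import all_classical all_reals all_analysis.
From mathcomp Require Import all_boot all_order all_algebra.
From mathcomp Require Import ring lra zify.

(** Lower bound: in a copy of S_r pick x_i in b_i \ a_i. For i <> j the set a_i
    contains b_j together with the r - 2 further points x_l (l <> i, j), which
    lie outside b_j, so r - 2 consecutive layers contain no copy.

    Upper bound: work in the power set of G and let F be S_r-free. Call a point
    y outside B marked by B when some b in F satisfies y \in b \subset y |: B,
    and let u(B) be the proportion of unmarked points outside B. For a fixed y,
    the sets b - y (y \in b \in F) together with the A in F that leave y
    unmarked form a family on G - y that embeds into F. If G is a smallest
    ground set on which the Lubell function exceeds a given bound, averaging
    over y gives sum_(A in F) u(A) / C(|G|, |A|) <= 1; the same holds for the
    dual notion of comarked points because S_r is self-dual.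

    Follow a random maximal chain through G. By Doob's maximal inequality, given
    that it passes through B, with probability at most 4 u(B) some initial
    segment of its continuation consists of unmarked points for at least a
    quarter. So on average at most 4 + 4 members of F on the chain are
    exceptional from above or from below. If B and A are two other members of F
    on the chain at distance d > 2 r, then more than d / 2 > r of the points of
    A \ B are both marked and comarked, and these yield a copy of S_r. Hence the
    Lubell function is at most 2 r + 9. *)

Set Implicit Arguments.
Unset Strict Implicit.
Unset Printing Implicit Defensive.

Import Order.TTheory GRing.Theory Num.Theory.
Import numFieldNormedType.Exports.
Local Open Scope ring_scope.

Lemma sub_powersetP (T : finType) (G : {set T}) (F : {set {set T}}) :
  reflect {in F, forall A : {set T}, A \subset G} (F \subset powerset G).
Proof. by apply: (iffP subsetP) => FG A /FG; rewrite powersetE. Qed.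

Arguments sub_powersetP {T G F}.

Lemma sum_cardsID1 (T : finType) (G U : {set T}) :
  (\sum_(x in G) #|U :&: (G :\ x)| = #|U :&: G| * #|G|.-1)%N.
Proof.
have count_memE : (\sum_(x in G) (x \in U :&: G) = #|U :&: G|)%N.
  rewrite -big_mkcondr -sum1_card; apply: eq_bigl => x.
  by rewrite in_setI andbCA andbb.
have : (\sum_(x in G) #|U :&: (G :\ x)| + #|U :&: G| = #|G| * #|U :&: G|)%N.
  rewrite -{1}count_memE -big_split -sum_nat_const; apply: eq_bigr => x _ /=.
  by rewrite setIDA addnC -cardsD1.
by case: #|G| => [|n] /=; lia.
Qed.

Section Orderings.
Variable T : finType.
Implicit Types (G U B : {set T}) (s : seq T).

Definition orderings G : seq (seq T) := permutations (enum G).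

Lemma mem_orderings G s :
  (s \in orderings G) = uniq s && ([set x in s] == G).
Proof.
rewrite mem_permutations; apply/idP/andP => [sG|[us /eqP <-]].
  rewrite (perm_uniq sG) enum_uniq; split=> //; apply/eqP/setP => x.
  by rewrite inE (perm_mem sG) mem_enum.
by apply: uniq_perm; rewrite ?enum_uniq // => x; rewrite mem_enum inE.
Qed.

Lemma size_orderings G : size (orderings G) = #|G| `!.
Proof. by rewrite size_permutations ?enum_uniq // -cardE. Qed.

Lemma ordering_set G s : s \in orderings G -> [set x in s] = G.
Proof. by rewrite mem_orderings => /andP[_ /eqP]. Qed.

Lemma ordering_count G U s :
  s \in orderings G -> count (mem U) s = #|U :&: G|.
Proof.
rewrite mem_orderings => /andP[us /eqP <-]; rewrite -size_filter.
have /card_uniqP <- : uniq [seq x <- s | mem U x] by rewrite filter_uniq.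
by apply: eq_card => x; rewrite mem_filter !inE.
Qed.

Lemma ordering_size G s : s \in orderings G -> size s = #|G|.
Proof. by rewrite mem_permutations cardE => /perm_size. Qed.

Lemma orderings0 : orderings set0 = [:: [::]].
Proof. by rewrite /orderings enum_set0. Qed.

Lemma cat_ordering G s1 s2 :
  (s1 ++ s2 \in orderings G) =
  [&& uniq s1, [set x in s1] \subset G &
      s2 \in orderings (G :\: [set x in s1])].
Proof.
rewrite !mem_orderings cat_uniq -!andbA; case: (uniq s1) => //=.
apply/and3P/and3P => [[/hasPn s2_s1 us2 /eqP <-]|[s1G us2 /eqP s2E]].
  split=> //; first by apply/subsetP => x; rewrite !inE mem_cat => ->.
  apply/eqP/setP => x; rewrite !inE mem_cat.
  by have [/s2_s1 ->|_] := boolP (x \in s2); rewrite ?orbT // orbF andNb.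
split=> //.
  apply/hasPn => x xs2; have : x \in [set x in s2] by rewrite inE.
  by rewrite s2E !inE => /andP[].
apply/eqP; rewrite -[RHS](setID _ [set x in s1]) -s2E (setIidPr s1G).
by apply/setP => x; rewrite !inE mem_cat.
Qed.

Lemma perm_orderings_split G :
  perm_eq
    [seq (take k s, drop k s) | s <- orderings G, k <- index_iota 0 #|G|.+1]
    [seq p | B <- enum (powerset G),
             p <- [seq (s1, s2) | s1 <- orderings B,
                                  s2 <- orderings (G :\: B)]].
Proof.
apply: uniq_perm => [||[s1 s2]].
- apply: allpairs_uniq; rewrite ?permutations_uniq ?iota_uniq //.
  move=> _ _ /allpairsP[[s k] [sG kG ->]] /allpairsP[[s' k'] [s'G k'G ->]].
  move: sG s'G kG k'G; rewrite !mem_index_iota /= !ltnS.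
  move=> sG s'G k_le k'_le [takeE dropE].
  congr (_, _).
    by rewrite -(cat_take_drop k s) takeE dropE cat_take_drop.
  move: (congr1 size takeE).
  by rewrite !size_takel ?(ordering_size sG) ?(ordering_size s'G).
- apply: allpairs_uniq_dep => [|B _|]; first exact: enum_uniq.
    by apply: allpairs_uniq; rewrite ?permutations_uniq // => - [? ?] [? ?].
  move=> _ _ /allpairsPdep[B [p [_ pB ->]]] /allpairsPdep[B' [p' [_ p'B' ->]]].
  move=> /= pE; move: pB p'B'; rewrite -{}pE => {p'}.
  move=> /allpairsP[[s1 s2] [/ordering_set /= <- _ ->]].
  by move=> /allpairsP[[s1' s2'] [/ordering_set /= <- _ [<- _]]].
apply/allpairsP/allpairsPdep => /=.
  move=> [[s k] [/= + _ [-> ->]]].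
  rewrite -{1}(cat_take_drop k s) cat_ordering => /and3P[us1 s1G s2G].
  exists [set x in take k s], (take k s, drop k s); split=> //.
    by rewrite mem_enum powersetE.
  by apply: allpairs_f; rewrite // mem_orderings us1 eqxx.
move=> [B [_ [+ /allpairsP[[t1 t2] [/= t1B t2B ->]] [-> ->]]]].
rewrite mem_enum powersetE => BG; exists (t1 ++ t2, size t1); split=> /=.
- move: t1B; rewrite mem_orderings cat_ordering => /andP[-> /eqP ->].
  by rewrite BG.
- by rewrite mem_index_iota ltnS (ordering_size t1B) subset_leq_card.
- by rewrite take_size_cat // drop_size_cat.
Qed.

Section Sums.
Variable V : nmodType.
Implicit Types (f : seq T -> V) (h : seq T -> seq T -> V).

Lemma sum_orderings_cons G f : G != set0 ->
  \sum_(s <- orderings G) f s =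
  \sum_(x in G) \sum_(s <- orderings (G :\ x)) f (x :: s).
Proof.
move=> G0; rewrite (perm_big _ (permutationsE _)); last first.
  by rewrite -cardE card_gt0.
rewrite big_allpairs_dep undup_id ?enum_uniq // big_enum.
apply: eq_bigr => x xG; apply/perm_big/perm_permutations/uniq_perm.
- by rewrite rem_uniq ?enum_uniq.
- exact: enum_uniq.
- by move=> y; rewrite mem_rem_uniq ?enum_uniq // !inE !mem_enum !inE.
Qed.

Lemma sum_orderings_rev G f :
  \sum_(s <- orderings G) f (rev s) = \sum_(s <- orderings G) f s.
Proof.
rewrite -(big_map rev xpredT f); apply/perm_big/uniq_perm.
- by rewrite map_inj_uniq ?permutations_uniq //; apply: can_inj revK.
- exact: permutations_uniq.
move=> s; rewrite -{1}[s]revK mem_map; last exact: can_inj revK.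
by rewrite !mem_permutations perm_rev.
Qed.

Lemma sum_orderings_split G h :
  \sum_(s <- orderings G) \sum_(k < #|G|.+1) h (take k s) (drop k s) =
  \sum_(B : {set T} | B \subset G)
    \sum_(s1 <- orderings B) \sum_(s2 <- orderings (G :\: B)) h s1 s2.
Proof.
transitivity (\sum_(p <- [seq (take k s, drop k s) |
    s <- orderings G, k <- index_iota 0 #|G|.+1]) h p.1 p.2).
  rewrite big_allpairs_dep; apply: eq_bigr => s _ /=.
  by rewrite (big_mkord xpredT (fun k => h (take k s) (drop k s))).
rewrite (perm_big _ (perm_orderings_split G)) big_allpairs_dep big_enum /=.
by apply: eq_big => B; rewrite ?powersetE ?big_allpairs.
Qed.

End Sums.

End Orderings.

Section Averages.
Variables (R : realFieldType) (T : finType).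
Implicit Types (F : {set {set T}}) (G A B U : {set T}) (f g : seq T -> R).

Definition ordering_avg G f : R := (\sum_(s <- orderings G) f s) / #|G| `!%:R.

Lemma le_ordering_avg G f g :
  (forall s, s \in orderings G -> f s <= g s) ->
  ordering_avg G f <= ordering_avg G g.
Proof.
by move=> fg; rewrite ler_wpM2r ?invr_ge0 ?ler0n // !big_seq; apply: ler_sum.
Qed.

Lemma eq_ordering_avg G f g :
  (forall s, s \in orderings G -> f s = g s) ->
  ordering_avg G f = ordering_avg G g.
Proof. by move=> fg; rewrite /ordering_avg !big_seq (eq_bigr _ fg). Qed.

Lemma ordering_avgD G f g :
  ordering_avg G (fun s => f s + g s) = ordering_avg G f + ordering_avg G g.
Proof. by rewrite /ordering_avg big_split mulrDl. Qed.

Lemma ordering_avg_cst G (c : R) : ordering_avg G (fun=> c) = c.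
Proof.
rewrite /ordering_avg big_const_seq count_predT iter_addr_0 size_orderings.
by rewrite -[c *+ _]mulr_natr mulfK // pnatr_eq0 -lt0n fact_gt0.
Qed.

Lemma ordering_avg_cons G f : G != set0 ->
  ordering_avg G f =
  (\sum_(x in G) ordering_avg (G :\ x) (fun s => f (x :: s))) / #|G|%:R.
Proof.
move=> G0; rewrite /ordering_avg sum_orderings_cons // !mulr_suml.
apply: eq_bigr => x xG; rewrite -mulrA -invfM -natrM mulnC.
by rewrite (cardsD1 x G) xG add1n factS.
Qed.

Lemma ordering_avg_rev G f :
  ordering_avg G (fun s => f (rev s)) = ordering_avg G f.
Proof. by rewrite /ordering_avg sum_orderings_rev. Qed.

Definition lubell_weight G A : R := 'C(#|G|, #|A|)%:R^-1.

Definition lubell_on G F : R := \sum_(A in F) lubell_weight G A.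

Lemma lubell_weight_ge0 G A : 0 <= lubell_weight G A.
Proof. by rewrite invr_ge0 ler0n. Qed.

(* The expected total of p over the members of F on the maximal chain of
   prefixes of a random ordering of G. *)
Definition chain_avg G F (p : seq T -> seq T -> R) : R :=
  ordering_avg G (fun s =>
    \sum_(k < #|G|.+1 | [set x in take k s] \in F) p (take k s) (drop k s)).

(* Given that the random chain passes through B, its parts below and above B
   are independent random orderings. *)
Lemma chain_avgE G F (p : seq T -> seq T -> R) : F \subset powerset G ->
  chain_avg G F p =
  \sum_(B in F) lubell_weight G B *
    ordering_avg B (fun s1 => ordering_avg (G :\: B) (p s1)).
Proof.
move=> FG; pose h s1 s2 := if [set x in s1] \in F then p s1 s2 else 0.
rewrite /chain_avg /ordering_avg; under eq_bigr do rewrite big_mkcond.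
rewrite (sum_orderings_split G h) mulr_suml big_mkcond [RHS]big_mkcond /=.
apply: eq_bigr => B _; have [BF|BF] := boolP (B \in F); last first.
  rewrite big_seq big1 ?mul0r ?if_same // => s1 /ordering_set s1B.
  by rewrite big1 // /h s1B (negbTE BF).
have BG : B \subset G by apply: (sub_powersetP FG).
have factE : #|G| `!%:R^-1 =
    lubell_weight G B * (#|B| `!%:R^-1 * #|G :\: B| `!%:R^-1) :> R.
  by rewrite -!invfM -!natrM cardsDS // bin_fact // subset_leq_card.
have -> : \sum_(s1 <- orderings B) \sum_(s2 <- orderings (G :\: B)) h s1 s2 =
    \sum_(s1 <- orderings B) \sum_(s2 <- orderings (G :\: B)) p s1 s2.
  rewrite !big_seq; apply: eq_bigr => s1 /ordering_set s1B.
  by apply: eq_bigr => s2 _; rewrite /h s1B BF.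
by rewrite BG factE -mulr_suml; ring.
Qed.

Fixpoint dense_suffix (q : nat) U (s : seq T) : bool :=
  if s is _ :: s' then
    (size s <= q * count (mem U) s)%N || dense_suffix q U s'
  else false.

Lemma dense_suffixPn q U (s : seq T) :
  reflect
    (forall k, (k < size s)%N -> (q * count (mem U) (drop k s) < size s - k)%N)
    (~~ dense_suffix q U s).
Proof.
elim: s => [|x s IH]; first by apply: ReflectT.
rewrite /= negb_or -ltnNge; apply: (iffP andP) => [[sx /IH dense_s] [|k]|dense].
- by rewrite subn0.
- by rewrite subSS; apply: dense_s.
- by split; [apply: (dense 0%N)|apply/IH => k; apply: (dense k.+1)].
Qed.

(* Doob's maximal inequality: the density of U in the suffix of length d of a
   random ordering is a martingale as d decreases. *)
Lemma ordering_avg_dense_suffix q G U :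
  ordering_avg G (fun s => (dense_suffix q U s)%:R) <=
  q%:R * (#|U :&: G|%:R / #|G|%:R).
Proof.
have [n] := ubnP #|G|; elim: n G => // n IH G leGn.
have [->|G0] := eqVneq G set0.
  by rewrite /ordering_avg orderings0 big_seq1 mul0r !mulr_ge0 ?invr_ge0 ?ler0n.
have Gn0 : 0 < #|G|%:R :> R by rewrite ltr0n card_gt0.
rewrite mulrA; have [dense|sparse] := leqP #|G| (q * #|U :&: G|).
  apply: (@le_trans _ _ 1); last by rewrite ler_pdivlMr // mul1r -natrM ler_nat.
  rewrite -[leRHS](ordering_avg_cst G 1); apply: le_ordering_avg => s _.
  by rewrite lern1 leq_b1.
have behead_dense s : s \in orderings G ->
    (dense_suffix q U s)%:R = (dense_suffix q U (behead s))%:R :> R.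
  case: s => [|x s] // sG /=.
  have := ordering_size sG; have := ordering_count U sG => /= -> ->.
  by rewrite leqNgt sparse.
rewrite (eq_ordering_avg behead_dense).
rewrite ordering_avg_cons // ler_pM2r ?invr_gt0 //=.
apply: (@le_trans _ _
    (\sum_(x in G) q%:R * (#|U :&: (G :\ x)|%:R / #|G|.-1%:R))).
  apply: ler_sum => x xG; have cardG : #|G :\ x| = #|G|.-1.
    by rewrite (cardsD1 x G) xG.
  rewrite -cardG; apply: IH.
  by rewrite cardG -ltnS prednK // card_gt0.
rewrite -mulr_sumr -mulr_suml -natr_sum sum_cardsID1 natrM ler_wpM2l ?ler0n //.
have [->|G1] := eqVneq (#|G|.-1%:R : R) 0; first by rewrite !mulr0 mul0r ler0n.
by rewrite mulfK.
Qed.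

Lemma ordering_avg_dense_suffix_rev q G U :
  ordering_avg G (fun s => (dense_suffix q U (rev s))%:R) <=
  q%:R * (#|U :&: G|%:R / #|G|%:R).
Proof.
rewrite (ordering_avg_rev G (fun s => (dense_suffix q U s)%:R)).
exact: ordering_avg_dense_suffix.
Qed.

End Averages.

Section Complements.
Variable T : finType.
Implicit Types (F : {set {set T}}) (G A B : {set T}).

Lemma setDDK G A : A \subset G -> G :\: (G :\: A) = A.
Proof. by move=> AG; rewrite setDDr setDv set0U (setIidPr AG). Qed.

Definition complements G F : {set {set T}} := [set G :\: A | A in F].

Lemma mem_complements G F A : F \subset powerset G -> A \subset G ->
  (G :\: A \in complements G F) = (A \in F).
Proof.
move=> /sub_powersetP FG AG.
apply/imsetP/idP => [[B BF GAB]|]; last by exists A.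
by rewrite -(setDDK AG) GAB setDDK ?FG.
Qed.

Lemma complements_sub G F : complements G F \subset powerset G.
Proof. by apply/sub_powersetP => _ /imsetP[A _ ->]; exact: subsetDl. Qed.

Lemma big_complements (V : nmodType) G F (f : {set T} -> V) :
  F \subset powerset G ->
  \sum_(A in complements G F) f A = \sum_(A in F) f (G :\: A).
Proof.
move=> /sub_powersetP FG; rewrite big_imset //= => A B /FG AG /FG BG.
by move/(congr1 (setD G)); rewrite !setDDK.
Qed.

End Complements.

Section Copies.
Variable T : finType.
Implicit Types (F : {set {set T}}) (G A B : {set T}).

Definition has_copy d (P : finPOrderType d) F : Prop :=
  exists2 f : P -> {set T}, (forall x, f x \in F) &
    forall x y, (f x \subset f y) = (x <= y)%O.

Lemma has_copy_embed d (P : finPOrderType d) F1 F2 (h : {set T} -> {set T}) :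
  {in F1, forall A, h A \in F2} ->
  {in F1 &, forall A B, (h A \subset h B) = (A \subset B)} ->
  has_copy P F1 -> has_copy P F2.
Proof.
move=> hF h_sub [f fF f_le]; exists (h \o f) => [x|x y] /=; first exact: hF.
by rewrite h_sub.
Qed.

Lemma has_copy_complements d (P : finPOrderType d) G F (op : P -> P) :
  {mono op : x y /~ (x <= y)%O} ->
  F \subset powerset G -> has_copy P (complements G F) -> has_copy P F.
Proof.
move=> op_le FG [f fF f_le].
have fG x : f x \subset G by apply: (sub_powersetP (complements_sub G F)).
exists (fun x => G :\: f (op x)) => [x|x y].
  by rewrite -(mem_complements FG) ?subsetDl // setDDK.
rewrite -op_le -f_le; apply/idP/idP; last exact: setDS.
by move/(setDS G); rewrite !setDDK.
Qed.

Definition std_swap r (x : std_example r) : std_example r :=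
  match x with inl i => inr i | inr i => inl i end.

Lemma std_swap_le r : {mono @std_swap r : x y /~ (x <= y)%O}.
Proof. by case=> i [] j; rewrite /Order.le //= eq_sym. Qed.

Lemma std_copy_of_points r F (e : 'I_r -> T) (a b : 'I_r -> {set T}) :
  (forall i, a i \in F) -> (forall i, b i \in F) ->
  (forall i j, (e i \in a j) = (i != j)) ->
  (forall i j, (e i \in b j) = (i == j)) ->
  (forall i j, i != j -> b j \subset a i) ->
  (forall i j, ~~ (a i \subset b j)) ->
  has_copy (std_example r) F.
Proof.
move=> aF bF e_a e_b b_sub_a a_nsub_b.
exists (fun x : std_example r => match x with inl i => a i | inr i => b i end).
  by case.
have separated (A B : {set T}) i :
    e i \in A -> e i \notin B -> (A \subset B) = false.
  by move=> iA iB; apply/negbTE/subsetPn; exists (e i).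
case=> i [] j; rewrite {1}/Order.le /=.
- have [->|ij] := eqVneq i j; first exact: subxx.
  by apply: (separated _ _ j); rewrite e_a ?eqxx // eq_sym.
- exact/negbTE.
- have [->|ij] := eqVneq j i; last exact: b_sub_a.
  by apply: (separated _ _ i); rewrite ?e_a ?e_b eqxx.
- have [->|ij] := eqVneq i j; first exact: subxx.
  by apply: (separated _ _ i); rewrite e_b ?eqxx.
Qed.

End Copies.

Section Marks.
Variable T : finType.
Implicit Types (F : {set {set T}}) (G A B X : {set T}).

Definition marked F B y : bool :=
  [exists b in F, (y \in b) && (b \subset y |: B)].

Definition comarked F A y : bool :=
  [exists a in F, (y \notin a) && (A :\ y \subset a)].

Lemma marked_complements F G A y :
  F \subset powerset G -> A \subset G -> y \in A ->
  marked (complements G F) (G :\: A) y = comarked F A y.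
Proof.
move=> FG AG yA; have yG := subsetP AG y yA.
have witnessE a : (y \in G :\: a) && (G :\: a \subset y |: (G :\: A)) =
    (y \notin a) && (A :\ y \subset a).
  rewrite inE yG andbT; congr (_ && _); apply/subsetP/subsetP => sub x.
    rewrite !inE => /andP[xy xA]; apply: contraT => xa.
    have := sub x; rewrite !inE xa (subsetP AG x xA) xA (negbTE xy).
    exact.
  rewrite !inE => /andP[xa xG]; rewrite xG andbT -implyNb; apply/implyP => xy.
  by apply: contra xa => xA; apply: sub; rewrite !inE xy.
apply/exists_inP/exists_inP => [[_ /imsetP[a aF ->]]|[a aF]].
  by rewrite witnessE; exists a.
by rewrite -witnessE; exists (G :\: a) => //; apply: imset_f.
Qed.

Lemma std_copy_of_marks r F A B X :
  B \subset A -> (2 < #|A :\: B|)%N -> X \subset A :\: B -> (r <= #|X|)%N ->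
  {in X, forall x, marked F B x} -> {in X, forall x, comarked F A x} ->
  has_copy (std_example r) F.
Proof.
move=> BA gap XAB rX markedX comarkedX.
pose e (i : 'I_r) : T := enum_val (widen_ord rX i).
have eX i : e i \in X := enum_valP _.
have e_eq i j : (e i == e j) = (i == j).
  by rewrite (inj_eq enum_val_inj) -val_eqE.
have /all_sig2[b bF bP] i :
    {b | b \in F & (e i \in b) && (b \subset e i |: B)}.
  exact/sig2W/exists_inP/markedX.
have /all_sig2[a aF aP] i :
    {a | a \in F & (e i \notin a) && (A :\ e i \subset a)}.
  exact/sig2W/exists_inP/comarkedX.
have eAB i : (e i \in A) * (e i \in B = false).
  by have /setDP[-> /negbTE ->] := subsetP XAB _ (eX i).
have e_b i j : (e i \in b j) = (i == j).
  have [ebj /subsetP bj] := andP (bP j).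
  have [->|ij] := eqVneq i j; first exact: ebj.
  by apply: contraFF (bj (e i)) _; rewrite !inE e_eq (negbTE ij) eAB.
have e_a i j : (e i \in a j) = (i != j).
  have [eaj /subsetP aj] := andP (aP j).
  have [->|ij] := eqVneq i j; first exact: negbTE.
  by apply: aj; rewrite !inE e_eq ij eAB.
apply: (std_copy_of_points aF bF e_a e_b) => i j.
  move=> ij; have [_ bj] := andP (bP j); have [_ ai] := andP (aP i).
  apply: subset_trans bj (subset_trans _ ai).
  by rewrite subUset sub1set subsetD1 !inE e_eq eq_sym ij !eAB BA.
apply: contraTN gap => ab; rewrite -leqNgt.
have [_ ai] := andP (aP i); have [_ bj] := andP (bP j).
have := subset_leq_card (subset_trans ai (subset_trans ab bj)).
by rewrite (cardsDS BA) cardsU1 eAB; have := cardsD1 (e i) A; rewrite eAB; lia.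
Qed.

End Marks.

Section Unmarked.
Variable T : finType.
Implicit Types (F : {set {set T}}) (G A B : {set T}).

Definition unmarked G F B : {set T} := [set y in G :\: B | ~~ marked F B y].

Definition counmarked F A : {set T} := [set y in A | ~~ comarked F A y].

Lemma unmarked_complements G F A : F \subset powerset G -> A \subset G ->
  unmarked G (complements G F) (G :\: A) = counmarked F A.
Proof.
move=> FG AG; apply/setP => y; rewrite !inE.
have [yA|yA] := boolP (y \in A); last by case: (y \in G).
by rewrite (subsetP AG) //= marked_complements.
Qed.

Definition link F y : {set {set T}} := [set A :\ y | A in F & y \in A].

Lemma mem_link F y B : (B \in link F y) = (y \notin B) && (y |: B \in F).
Proof.
apply/imsetP/andP => [[A]|[yB BF]].
  by rewrite inE => /andP[AF yA] ->; rewrite setD1K // !inE eqxx.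
by exists (y |: B); rewrite ?inE ?BF ?eqxx // setU1K.
Qed.

Definition unmarking G F y : {set {set T}} :=
  [set A in F | y \in unmarked G F A].

Definition contraction G F y : {set {set T}} := link F y :|: unmarking G F y.

Lemma disjoint_contraction G F y : [disjoint link F y & unmarking G F y].
Proof.
apply/pred0P => B /=; apply/negP => /andP[]; rewrite mem_link => /andP[_ yBF].
rewrite !inE => /and3P[_ _ /exists_inP[]].
by exists (y |: B); rewrite ?setU11 //=.
Qed.

Lemma contraction_sub G F y :
  F \subset powerset G -> contraction G F y \subset powerset (G :\ y).
Proof.
move=> /sub_powersetP FG; rewrite subUset; apply/andP; split.
  apply/sub_powersetP => B; rewrite mem_link subsetD1 => /andP[-> /FG].
  by rewrite andbT => /(subset_trans (subsetU1 _ _)).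
apply/sub_powersetP => B; rewrite !inE => /andP[/FG BG /andP[/andP[yB _] _]].
by rewrite subsetD1 BG.
Qed.

(* If B leaves y unmarked then B contains no A with y |: A in F, so adding y
   back exactly to the members of the link is an order embedding into F. *)
Lemma has_copy_contraction d (P : finPOrderType d) G F y :
  has_copy P (contraction G F y) -> has_copy P F.
Proof.
pose h B := if y |: B \in F then y |: B else B.
apply: (@has_copy_embed _ _ _ _ _ h) => [B|A B].
  by rewrite inE mem_link inE /h; case: ifP => // _; rewrite andbF => /andP[].
have notin C : C \in contraction G F y -> y \notin C.
  by rewrite inE mem_link !inE => /orP[/andP[]|/and3P[_ /andP[]]].
have unmark C : C \in contraction G F y -> y |: C \notin F -> ~~ marked F C y.
  by rewrite inE mem_link !inE => /orP[/andP[_ ->]|/and3P[]].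
move=> Ac Bc; have yA := notin A Ac; have yB := notin B Bc.
have sub_yB : (A \subset y |: B) = (A \subset B).
  by rewrite -subDset (setDidPl _) // disjoint_sym disjoints1.
rewrite /h; case: ifPn => yAF; case: ifPn => yBF //.
  by rewrite subUset sub1set setU11 sub_yB.
rewrite subUset sub1set (negbTE yB) /=; apply/esym/negbTE.
apply: contra (unmark B Bc yBF) => AB; apply/exists_inP.
by exists (y |: A); rewrite ?setU11 ?setUS.
Qed.

End Unmarked.

Section Contraction.
Variables (R : realFieldType) (T : finType).
Implicit Types (F : {set {set T}}) (G A B : {set T}).

Lemma lubell_weightD1_mem G A y : A \subset G -> y \in A ->
  lubell_weight R (G :\ y) (A :\ y) / #|G|%:R = lubell_weight R G A / #|A|%:R.
Proof.
move=> AG yA; rewrite /lubell_weight -!invfM -!natrM.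
rewrite (cardsD1 y A) (cardsD1 y G) (subsetP AG) // yA !add1n.
by rewrite mulnC mul_bin_diag mulnC.
Qed.

Lemma lubell_weightD1_notin G A y : A \subset G -> y \in G ->
  lubell_weight R (G :\ y) A / #|G|%:R = lubell_weight R G A / #|G :\: A|%:R.
Proof.
move=> AG yG; rewrite /lubell_weight -!invfM -!natrM (cardsDS AG).
by rewrite (mulnC 'C(#|G|, _)) -mul_bin_down (cardsD1 y G) yG mulnC.
Qed.

Lemma lubell_weightDr G A : A \subset G ->
  lubell_weight R G (G :\: A) = lubell_weight R G A.
Proof.
by move=> AG; rewrite /lubell_weight cardsDS // bin_sub // subset_leq_card.
Qed.

Lemma lubell_on_complements G F : F \subset powerset G ->
  lubell_on R G (complements G F) = lubell_on R G F.
Proof.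
move=> FG; rewrite /lubell_on big_complements //.
by apply: eq_bigr => A AF; rewrite lubell_weightDr // (sub_powersetP FG).
Qed.

Lemma exchange_sum_mem G F (S : {set T} -> {set T}) (c : {set T} -> R) :
  {in F, forall A, S A \subset G} ->
  \sum_(y in G) \sum_(A in F | y \in S A) c A = \sum_(A in F) c A * #|S A|%:R.
Proof.
move=> SG; rewrite (exchange_big_dep (mem F)) /=; last by move=> y A _ /andP[].
apply: eq_bigr => A AF; rewrite mulr_natr -sumr_const; apply: eq_bigl => y.
by rewrite AF /= andb_idl // => /(subsetP (SG A AF)).
Qed.

Lemma sum_lubell_link G F : F \subset powerset G ->
  (\sum_(y in G) lubell_on R (G :\ y) (link F y)) / #|G|%:R =
  lubell_on R G (F :\ set0).
Proof.
move=> /sub_powersetP FG.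
have linkE y : lubell_on R (G :\ y) (link F y) =
    \sum_(A in F | y \in A) lubell_weight R (G :\ y) (A :\ y).
  rewrite /lubell_on big_imset /=; first by apply: eq_bigl => A; rewrite inE.
  move=> A B; rewrite !inE => /andP[_ yA] /andP[_ yB] /(congr1 (setU [set y])).
  by rewrite !setD1K.
transitivity (\sum_(y in G) \sum_(A in F | y \in A)
    lubell_weight R G A / #|A|%:R).
  rewrite mulr_suml; apply: eq_bigr => y _; rewrite linkE mulr_suml.
  by apply: eq_bigr => A /andP[/FG AG yA]; rewrite lubell_weightD1_mem.
rewrite (exchange_sum_mem (S := id)) // /lubell_on.
rewrite big_mkcond [RHS]big_mkcond; apply: eq_bigr => A _; rewrite !inE.
have [->|A0] := eqVneq A set0; first by rewrite cards0 mulr0 if_same.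
by rewrite mulfVK // pnatr_eq0 cards_eq0.
Qed.

Definition unmarked_sum G F : R :=
  \sum_(A in F) lubell_weight R G A * (#|unmarked G F A|%:R / #|G :\: A|%:R).

Definition counmarked_sum G F : R :=
  \sum_(A in F) lubell_weight R G A * (#|counmarked F A|%:R / #|A|%:R).

Lemma unmarked_sum_complements G F : F \subset powerset G ->
  unmarked_sum G (complements G F) = counmarked_sum G F.
Proof.
move=> FG; rewrite /unmarked_sum big_complements //.
apply: eq_bigr => A AF.
have AG : A \subset G by apply: (sub_powersetP FG).
by rewrite setDDK // unmarked_complements // lubell_weightDr.
Qed.

Lemma sum_lubell_unmarking G F : F \subset powerset G ->
  (\sum_(y in G) lubell_on R (G :\ y) (unmarking G F y)) / #|G|%:R =
  unmarked_sum G F.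
Proof.
move=> /sub_powersetP FG.
transitivity (\sum_(y in G) \sum_(A in F | y \in unmarked G F A)
    lubell_weight R G A / #|G :\: A|%:R).
  rewrite mulr_suml; apply: eq_bigr => y yG; rewrite /lubell_on mulr_suml.
  apply: eq_big => A; rewrite inE // => /andP[/FG AG _].
  exact: lubell_weightD1_notin.
rewrite exchange_sum_mem => [|A _]; last first.
  by apply/subsetP => y; rewrite !inE => /andP[/andP[]].
by apply: eq_bigr => A _; rewrite mulrAC mulrA.
Qed.

Lemma sum_lubell_contraction G F : F \subset powerset G ->
  (\sum_(y in G) lubell_on R (G :\ y) (contraction G F y)) / #|G|%:R =
  lubell_on R G (F :\ set0) + unmarked_sum G F.
Proof.
move=> FG; rewrite -sum_lubell_link // -sum_lubell_unmarking // -mulrDl.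
rewrite -big_split; congr (_ / _); apply: eq_bigr => y _.
rewrite /lubell_on -bigU ?disjoint_contraction //=.
by apply: eq_bigl => A; rewrite inE.
Qed.

Lemma lubell_on_le_setD0 G F : lubell_on R G F <= 1 + lubell_on R G (F :\ set0).
Proof.
rewrite /lubell_on; have [F0|F0] := boolP (set0 \in F).
  by rewrite (big_setD1 set0) //= /lubell_weight cards0 bin0 invr1.
by rewrite (setDidPl _) ?lerDr ?ler01 // disjoint_sym disjoints1.
Qed.

Lemma unmarked_sum_le1 d (P : finPOrderType d) G F (c : R) :
  F \subset powerset G -> ~ has_copy P F ->
  (forall y F', y \in G -> F' \subset powerset (G :\ y) -> ~ has_copy P F' ->
     lubell_on R (G :\ y) F' <= c) ->
  c <= lubell_on R G F ->
  unmarked_sum G F <= 1.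
Proof.
move=> FG Ffree leD1 cF; have [->|G0] := eqVneq G set0.
  rewrite /unmarked_sum big1 ?ler01 // => A _.
  by rewrite set0D cards0 invr0 !mulr0.
have avg_le :
    (\sum_(y in G) lubell_on R (G :\ y) (contraction G F y)) / #|G|%:R <= c.
  rewrite ler_pdivrMr ?ltr0n ?card_gt0 // mulr_natr -sumr_const.
  apply: ler_sum => y yG; apply: leD1 => //; first exact: contraction_sub.
  by move/has_copy_contraction.
rewrite sum_lubell_contraction // in avg_le.
by have := lubell_on_le_setD0 G F; lra.
Qed.

Lemma counmarked_sum_le1 d (P : finPOrderType d) (op : P -> P) G F (c : R) :
  {mono op : x y /~ (x <= y)%O} ->
  F \subset powerset G -> ~ has_copy P F ->
  (forall y F', y \in G -> F' \subset powerset (G :\ y) -> ~ has_copy P F' ->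
     lubell_on R (G :\ y) F' <= c) ->
  c <= lubell_on R G F ->
  counmarked_sum G F <= 1.
Proof.
move=> op_le FG Ffree leD1 cF; rewrite -unmarked_sum_complements //.
apply: (unmarked_sum_le1 (complements_sub G F) _ leD1).
  by move/(has_copy_complements op_le FG).
by rewrite lubell_on_complements.
Qed.

End Contraction.

Section Windows.
Variable T : finType.
Implicit Types (U : {set T}) (s : seq T).

Lemma window_set s j k : uniq s -> (j <= k)%N ->
  [set x in drop j (take k s)] = [set x in take k s] :\: [set x in take j s].
Proof.
move=> us jk; have takeE : take k s = take j s ++ drop j (take k s).
  by rewrite -{1}(cat_take_drop j (take k s)) take_takel.
have := take_uniq k us; rewrite {1}takeE cat_uniq => /and3P[_ /hasPn disj _].
apply/setP => x; rewrite !inE {2}takeE mem_cat.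
by have [/disj ->|_] := boolP (x \in drop j _); rewrite ?orbT ?orbF ?andNb.
Qed.

Lemma card_window s j k : uniq s -> (j <= k <= size s)%N ->
  #|[set x in take k s] :\: [set x in take j s]| = (k - j)%N.
Proof.
move=> us /andP[jk ks]; rewrite -window_set // cardsE.
by rewrite (card_uniqP _) ?drop_uniq ?take_uniq // size_drop size_takel.
Qed.

Lemma card_setI_window s j k U : uniq s -> (j <= k)%N ->
  #|U :&: ([set x in take k s] :\: [set x in take j s])| =
  count (mem U) (drop j (take k s)).
Proof.
move=> us jk; rewrite -window_set //; apply/esym/ordering_count.
by rewrite mem_orderings eqxx drop_uniq ?take_uniq.
Qed.

Lemma sparse_window_above q U s j k : (j < k <= size s)%N ->
  ~~ dense_suffix q U (rev (drop j s)) ->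
  (q * count (mem U) (drop j (take k s)) < k - j)%N.
Proof.
move=> /andP[jk ks] /dense_suffixPn; rewrite size_rev size_drop.
move=> /(_ (size s - k)%N); rewrite drop_rev count_rev size_drop.
have -> : (size s - j - (size s - k) = k - j)%N by lia.
by rewrite take_drop subnK ?(ltnW jk) //; apply; lia.
Qed.

Lemma sparse_window_below q U s j k : (j < k <= size s)%N ->
  ~~ dense_suffix q U (take k s) ->
  (q * count (mem U) (drop j (take k s)) < k - j)%N.
Proof.
move=> /andP[jk ks] /dense_suffixPn; rewrite size_takel //.
exact.
Qed.

End Windows.

Lemma card_ord_diam_le n D (Q : pred 'I_n) :
  (forall i j, Q i -> Q j -> (j <= i + D)%N) -> (#|Q| <= D.+1)%N.
Proof.
move=> close; have [i0 Qi0|Q0] := pickP Q; last by rewrite eq_card0.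
have [i Qi i_min] := arg_minnP val Qi0.
pose shift (j : 'I_n) : 'I_D.+1 := inord (j - i).
rewrite -[D.+1]card_ord -(@card_in_imset _ _ shift); first exact: max_card.
move=> j k Qj Qk /(congr1 val); rewrite /shift /= !inordK.
- by move=> jk; apply: val_inj; move: (i_min j Qj) (i_min k Qk) => /=; lia.
- by have := close i k Qi Qk; lia.
- by have := close i j Qi Qj; lia.
Qed.

Section UpperBound.
Variables (R : realFieldType) (T : finType).
Implicit Types (F : {set {set T}}) (G A B : {set T}) (s : seq T).

Definition unmarked_dense_above G F s1 s2 : bool :=
  dense_suffix 4 (unmarked G F [set x in s1]) (rev s2).

Definition counmarked_dense_below F s1 : bool :=
  dense_suffix 4 (counmarked F [set x in s1]) s1.

Lemma std_copy_of_few_unmarked r G F A B : (0 < r)%N ->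
  B \subset A -> A \subset G -> (2 * r < #|A :\: B|)%N ->
  (4 * #|unmarked G F B :&: (A :\: B)| < #|A :\: B|)%N ->
  (4 * #|counmarked F A :&: (A :\: B)| < #|A :\: B|)%N ->
  has_copy (std_example r) F.
Proof.
move=> r0 BA AG gap few_unmarked few_counmarked.
pose U := unmarked G F B :|: counmarked F A.
apply: (@std_copy_of_marks _ _ F A B ((A :\: B) :\: U)) => //.
- by lia.
- exact: subsetDl.
- have := cardsID U (A :\: B); rewrite [_ :&: U]setIC setIUl.
  have [+ _] := leq_card_setU (unmarked G F B :&: (A :\: B))
                              (counmarked F A :&: (A :\: B)).
  by lia.
- move=> x; rewrite !inE => /andP[+ /andP[xB xA]].
  by rewrite xB (subsetP AG) //= negb_or negbK => /andP[].
- move=> x; rewrite !inE => /andP[+ /andP[xB xA]].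
  by rewrite xA /= negb_or negbK => /andP[].
Qed.

Lemma sparse_positions_close r G F s j k : (0 < r)%N ->
  ~ has_copy (std_example r) F -> s \in orderings G -> (k <= #|G|)%N ->
  ~~ unmarked_dense_above G F (take j s) (drop j s) ->
  ~~ counmarked_dense_below F (take k s) ->
  (k <= j + 2 * r)%N.
Proof.
move=> r0 Ffree sG kG sparse_above sparse_below.
rewrite leqNgt; apply/negP => gap; apply: Ffree.
have jk : (j < k <= size s)%N by rewrite (ordering_size sG); lia.
have j_le_k : (j <= k)%N by lia.
move: (sG); rewrite mem_orderings => /andP[us /eqP setG].
apply: (@std_copy_of_few_unmarked _ G F
  [set x in take k s] [set x in take j s]) => //.
- by apply/subsetP => x; rewrite !inE -(take_takel s j_le_k); apply: mem_take.
- by rewrite -setG; apply/subsetP => x; rewrite !inE; apply: mem_take.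
- by rewrite card_window //; lia.
- by rewrite card_setI_window // card_window ?sparse_window_above //; lia.
- by rewrite card_setI_window // card_window ?sparse_window_below //; lia.
Qed.

Lemma chain_avg_unmarked_dense G F : F \subset powerset G ->
  chain_avg G F (fun s1 s2 => (unmarked_dense_above G F s1 s2)%:R) <=
  4 * unmarked_sum R G F.
Proof.
move=> FG; rewrite chain_avgE // /unmarked_sum mulr_sumr.
apply: ler_sum => A AF; rewrite [leRHS]mulrCA ler_wpM2l ?lubell_weight_ge0 //.
rewrite -[leRHS](ordering_avg_cst A); apply: le_ordering_avg => s1.
move=> /ordering_set s1A; rewrite /unmarked_dense_above s1A.
apply: le_trans (ordering_avg_dense_suffix_rev R _ _ _) _.
rewrite ler_wpM2l ?ler0n //.
by rewrite ler_wpM2r ?invr_ge0 ?ler0n // ler_nat subset_leq_card // subsetIl.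
Qed.

Lemma chain_avg_counmarked_dense G F : F \subset powerset G ->
  chain_avg G F (fun s1 _ => (counmarked_dense_below F s1)%:R) <=
  4 * counmarked_sum R G F.
Proof.
move=> FG; rewrite chain_avgE // /counmarked_sum mulr_sumr.
apply: ler_sum => A AF; rewrite [leRHS]mulrCA ler_wpM2l ?lubell_weight_ge0 //.
apply: le_trans (_ : ordering_avg A
    (fun s1 => (dense_suffix 4 (counmarked F A) s1)%:R) <= _).
  apply: le_ordering_avg => s1 /ordering_set s1A.
  by rewrite ordering_avg_cst /counmarked_dense_below s1A.
apply: le_trans (ordering_avg_dense_suffix R _ _ _) _.
rewrite ler_wpM2l ?ler0n //.
by rewrite ler_wpM2r ?invr_ge0 ?ler0n // ler_nat subset_leq_card // subsetIl.
Qed.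

Lemma lubell_on_chain_avg G F : F \subset powerset G ->
  lubell_on R G F = chain_avg G F (fun _ _ => 1).
Proof.
move=> FG; rewrite chain_avgE //; apply: eq_bigr => A _.
by rewrite !ordering_avg_cst mulr1.
Qed.

Lemma lubell_on_le_unmarked_sums r G F : (0 < r)%N ->
  F \subset powerset G -> ~ has_copy (std_example r) F ->
  lubell_on R G F <=
  (2 * r + 1)%:R + 4 * unmarked_sum R G F + 4 * counmarked_sum R G F.
Proof.
move=> r0 FG Ffree; rewrite lubell_on_chain_avg //.
apply: le_trans (lerD (lerD (lexx _) (chain_avg_unmarked_dense FG))
                      (chain_avg_counmarked_dense FG)).
rewrite -[X in X + _ + _](ordering_avg_cst G) -!ordering_avgD.
apply: le_ordering_avg => s sG; rewrite -addrA -big_split /=.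
pose sparse (k : 'I_#|G|.+1) :=
  ~~ unmarked_dense_above G F (take k s) (drop k s) &&
  ~~ counmarked_dense_below F (take k s).
have few_sparse : \sum_(k < #|G|.+1 | [set x in take k s] \in F) (sparse k)%:R
    <= (2 * r + 1)%:R :> R.
  rewrite -natr_sum ler_nat -big_mkcondr sum1_card addn1.
  apply: card_ord_diam_le => j k.
  move=> /andP[_ /andP[sparse_j _]] /andP[_ /andP[_ sparse_k]].
  apply: (sparse_positions_close r0 Ffree sG) sparse_j sparse_k.
  by rewrite -ltnS.
rewrite -lerBlDr; apply: le_trans few_sparse; rewrite -sumrB.
apply: ler_sum => k _; rewrite /sparse.
by case: unmarked_dense_above; case: counmarked_dense_below => /=; lra.
Qed.

Lemma lubell_on_std_le r G F : (0 < r)%N ->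
  F \subset powerset G -> ~ has_copy (std_example r) F ->
  lubell_on R G F <= (2 * r + 9)%:R.
Proof.
move=> r0; have [n] := ubnP #|G|; elim: n G F => // n IH G F leGn FG Ffree.
have leD1 y F' : y \in G -> F' \subset powerset (G :\ y) ->
    ~ has_copy (std_example r) F' -> lubell_on R (G :\ y) F' <= (2 * r + 9)%:R.
  by move=> yG; apply: IH; move: leGn; rewrite (cardsD1 y G) yG.
rewrite leNgt; apply/negP => exceeds.
have unmarked_le1 := unmarked_sum_le1 FG Ffree leD1 (ltW exceeds).
have counmarked_le1 :=
  counmarked_sum_le1 (@std_swap_le r) FG Ffree leD1 (ltW exceeds).
have := lubell_on_le_unmarked_sums r0 FG Ffree.
by move: exceeds; rewrite !natrD; lra.
Qed.

End UpperBound.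

Section FamiliesOfSubsets.
Variables (d : Order.disp_t) (P : finPOrderType d) (n : nat).
Implicit Types F : {set {set 'I_n}}.

Lemma contains_copyP F : reflect (has_copy P F) (contains_copy P F).
Proof.
apply: (iffP existsP) => [[G /andP[GF /existsP[f]]]|[f fF f_le]].
  case/and3P=> _ /eqP fG /forallP f_le; exists f => [x|x y].
    by apply: (subsetP GF); rewrite -fG imset_f.
  exact/eqP/(forallP (f_le x)).
have f_inj : injective f.
  by move=> x y fxy; apply: le_anti; rewrite -!f_le fxy subxx.
exists [set f x | x : P]; apply/andP; split.
  by apply/subsetP => _ /imsetP[x _ ->].
apply/existsP; exists (finfun f); apply/and3P; split.
- by apply/injectiveP => x y; rewrite !ffunE => /f_inj.
- by apply/eqP/eq_imset => x; rewrite ffunE.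
- by apply/forallP => x; apply/forallP => y; rewrite !ffunE f_le.
Qed.

Lemma poset_freeP F : reflect (~ has_copy P F) (poset_free P F).
Proof. by apply: (iffP negP) => no_copy /contains_copyP. Qed.

Lemma poset_free_set0 : P -> poset_free P (set0 : {set {set 'I_n}}).
Proof. by move=> x; apply/poset_freeP => -[f /(_ x)]; rewrite inE. Qed.

End FamiliesOfSubsets.

Lemma std_copy_gap r (T : finType) (F : {set {set T}}) : (1 < r)%N ->
  has_copy (std_example r) F ->
  exists A B : {set T}, [/\ A \in F, B \in F & (#|B| + (r - 2) <= #|A|)%N].
Proof.
move=> r1 [f fF f_le]; pose a l := f (inl l); pose b l := f (inr l).
have b_sub_a (l m : 'I_r) : (b l \subset a m) = (m != l) by rewrite f_le.
have /all_sig2[x xb xa] l : {x | x \in b l & x \notin a l}.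
  by apply/sig2W/subsetPn; rewrite b_sub_a eqxx.
have x_notin_b l m : m != l -> x m \notin b l.
  by move=> lm; apply: contra (xa m); apply: subsetP; rewrite b_sub_a.
have x_inj : injective x.
  move=> l m xlm; apply: contraTeq (xb l) => lm.
  by rewrite xlm x_notin_b // eq_sym.
pose i := Ordinal (ltnW r1); pose j := Ordinal r1.
have ij : i != j by [].
exists (a i), (b j); split; [exact: fF|exact: fF|].
pose X := x @: ~: [set i; j].
have cardX : #|X| = (r - 2)%N.
  by rewrite card_imset // cardsCs setCK card_ord cards2 ij.
have bX0 : [disjoint b j & X].
  rewrite disjoint_sym disjoints_subset; apply/subsetP => _ /imsetP[l + ->].
  by rewrite !inE negb_or => /andP[_ /x_notin_b].
have <- : #|b j :|: X| = (#|b j| + (r - 2))%N.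
  by rewrite -cardX; apply/eqP; rewrite (leq_card_setU (b j) X).
apply: subset_leq_card; rewrite subUset b_sub_a ij /=.
apply/subsetP => _ /imsetP[l + ->]; rewrite !inE negb_or => /andP[li _].
by apply: (subsetP _ _ (xb l)); rewrite b_sub_a eq_sym.
Qed.

Definition middle_layers n k : {set {set 'I_n}} :=
  [set A : {set 'I_n} | (n./2 <= #|A| < n./2 + k)%N].

Lemma middle_layers_std_free n r : (0 < r)%N ->
  poset_free (std_example r) (middle_layers n (r - 2)).
Proof.
move=> r0; have [r2|r2] := leqP r 2.
  have -> : middle_layers n (r - 2) = set0.
    by apply/setP => A; rewrite !inE; apply/negbTE; lia.
  exact: (poset_free_set0 n (inl (Ordinal r0) : std_example r)).
apply/poset_freeP => /std_copy_gap[|A [B []]]; first by lia.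
by rewrite !inE; lia.
Qed.

Lemma card_middle_layers n k :
  #|middle_layers n k| = (\sum_(j < k) 'C(n, n./2 + j))%N.
Proof.
elim: k => [|k IH].
  by rewrite big_ord0; apply: eq_card0 => A; rewrite inE addn0 ltnNge andbN.
have layerE : 'C(n, n./2 + k) = #|[set A : {set 'I_n} | #|A| == (n./2 + k)%N]|.
  by rewrite card_draws card_ord.
rewrite big_ord_recr /= -IH layerE.
rewrite -(cardsID (middle_layers n k) (middle_layers n k.+1)).
by congr (_ + _)%N; apply: eq_card => A; rewrite !inE; lia.
Qed.

Lemma bin_half_add_le n j : ('C(n, n./2 + j) <= 'C(n, n./2))%N.
Proof.
elim: j => [|j]; first by rewrite addn0.
apply: leq_trans; rewrite addnS -(@leq_pmul2l (n./2 + j).+1) // mul_bin_left.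
by rewrite leq_mul2r; apply/orP; right; lia.
Qed.

Lemma bin_half_add_ge n j :
  (n.+1 * 'C(n, n./2) <= n.+1 * 'C(n, n./2 + j) + 2 * j ^ 2 * 'C(n, n./2))%N.
Proof.
elim: j => [|j IH]; first by rewrite addn0 leq_addr.
have n_le : (n.+1 <= 2 * (n./2 + j).+1)%N by lia.
have decrease : (n.+1 * ('C(n, n./2 + j) - 'C(n, (n./2 + j).+1)) <=
    2 * (2 * j + 1) * 'C(n, n./2))%N.
  apply: leq_trans (leq_mul n_le (leqnn _)) _.
  rewrite -!mulnA leq_mul2l /= mulnBr mul_bin_left -mulnBl.
  by apply: leq_mul (bin_half_add_le n j); lia.
by rewrite addnS; nia.
Qed.

Lemma bin_le_half n k : ('C(n, k) <= 'C(n, n./2))%N.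
Proof.
have [nk|kn] := ltnP n k; first by rewrite bin_small.
have [hk|kh] := leqP n./2 k; first by rewrite -(subnKC hk) bin_half_add_le.
rewrite -bin_sub //; have hk : (n./2 <= n - k)%N by lia.
by rewrite -(subnKC hk) bin_half_add_le.
Qed.

Lemma bin_half_gt0 n : (0 < 'C(n, n./2))%N.
Proof. by rewrite bin_gt0; lia. Qed.

Section Thresholds.
Variable R : realType.

Lemma cvg_bin_half_ratio j :
  ('C(n, n./2 + j)%:R / 'C(n, n./2)%:R @[n --> \oo] --> (1 : R))%classic.
Proof.
pose lower n : R := 1 - (2 * j ^ 2)%:R * harmonic n.
have lower_cvg : (lower @ \oo --> (1 : R))%classic.
  rewrite -[X in (_ --> X)%classic](subr0 1).
  rewrite -[X in 1 - X](mulr0 (2 * j ^ 2)%:R).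
  by apply: cvgB; [exact: cvg_cst|apply: cvgMr; exact: cvg_harmonic].
apply: (@squeeze_cvgr _ _ _ _ lower (cst 1)) lower_cvg (cvg_cst _).
apply: nearW => n.
have c0 : 0 < 'C(n, n./2)%:R :> R by rewrite ltr0n bin_half_gt0.
rewrite ler_pdivlMr // ler_pdivrMr // mul1r ler_nat bin_half_add_le andbT.
rewrite /lower /harmonic /= -(ler_pM2l (ltr0Sn R n)) mulrA mulrBr mulr1.
rewrite mulrCA mulfV ?pnatr_eq0 // mulr1 mulrBl -!natrM lerBlDr -natrD ler_nat.
exact: bin_half_add_ge.
Qed.

Lemma lee_limn_esup (u v : (\bar R)^nat) :
  (forall n, (u n <= v n)%E) -> (limn_esup u <= limn_esup v)%E.
Proof.
move=> uv; rewrite !limn_esup_lim; apply: lee_lim; [exact: is_cvg_esups..|].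
apply: nearW => n; apply: ge_ereal_sup => _ [m nm <-].
by apply: le_trans (uv m) _; apply: ereal_sup_ubound; exists m.
Qed.

Lemma pi_star_ge_layers d (P : finPOrderType d) k :
  (forall n, poset_free P (middle_layers n k)) ->
  ((k%:R : R)%:E <= pi_star R P)%E.
Proof.
move=> layers_free.
pose u n : R := \sum_(j < k) 'C(n, n./2 + j)%:R / 'C(n, n./2)%:R.
have u_cvg : ((EFin \o u) @ \oo --> (k%:R : R)%:E)%classic.
  apply: cvg_EFin; first exact: nearW.
  have -> : k%:R = \sum_(j < k) 1 :> R by rewrite sumr_const card_ord.
  apply: cvg_big => [|j _]; first exact: add_continuous.
  exact: cvg_bin_half_ratio.
rewrite -(cvg_limn_einf_sup u_cvg).2; apply: lee_limn_esup => n /=.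
rewrite lee_fin /u -mulr_suml ler_wpM2r ?invr_ge0 ?ler0n //.
rewrite -natr_sum -card_middle_layers ler_nat.
exact: leq_bigmax_cond.
Qed.

Lemma card_le_lubell n (F : {set {set 'I_n}}) :
  #|F|%:R / 'C(n, n./2)%:R <= lubell R F.
Proof.
rewrite -sum1_card natr_sum mulr_suml; apply: ler_sum => A _.
rewrite mul1r lef_pV2 ?posrE ?ltr0n ?bin_half_gt0 ?ler_nat ?bin_le_half //.
by rewrite bin_gt0 -[leqRHS](card_ord n) max_card.
Qed.

Lemma pi_star_le_Lambda_star d (P : finPOrderType d) : P ->
  (pi_star R P <= Lambda_star R P)%E.
Proof.
move=> x; rewrite /pi_star limn_esup_lim.
apply: lime_le; first exact: is_cvg_esups.
exists 1%N => // n /= n0; apply: ge_ereal_sup => _ [m /= nm <-].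
have [F Ffree FLa] :
    {F : {set {set 'I_m}} | poset_free P F & La_star P m = #|F|}.
  apply: eq_bigmax_cond; apply/card_gt0P; exists set0.
  exact: poset_free_set0.
apply: le_trans (_ : ((lubell R F)%:E <= _)%E).
  by rewrite lee_fin FLa card_le_lubell.
by apply: ereal_sup_ubound; exists m, F; split=> //; apply: leq_trans nm.
Qed.

Lemma lubell_on_setT n (F : {set {set 'I_n}}) : lubell_on R setT F = lubell R F.
Proof. by apply: eq_bigr => A _; rewrite /lubell_weight cardsT card_ord. Qed.

Lemma Lambda_star_std_le r : (0 < r)%N ->
  (Lambda_star R (std_example r) <= ((2 * r + 9)%:R : R)%:E)%E.
Proof.
move=> r0; apply: ge_ereal_sup => _ [n [F [_ /poset_freeP Ffree ->]]].
rewrite lee_fin -lubell_on_setT; apply: lubell_on_std_le => //.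
by apply/sub_powersetP => A _; exact: subsetT.
Qed.

End Thresholds.

Theorem theorem3p11 (R : realType) (r : nat) (hr : (0 < r)%N) :
  [/\ ((r%:R - 2 : R)%:E <= pi_star R (std_example r))%E,
      (pi_star R (std_example r) <= Lambda_star R (std_example r))%E
    & (Lambda_star R (std_example r) <=
        (2 * r%:R + Num.sqrt ((16 * ln 2) * r%:R) + 11 : R)%:E)%E].
Proof.
split.
- apply: le_trans (pi_star_ge_layers R (fun n => middle_layers_std_free n hr)).
  by rewrite lee_fin lerBlDr -natrD ler_nat; lia.
- exact: (pi_star_le_Lambda_star R (inl (Ordinal hr) : std_example r)).
- apply: le_trans (Lambda_star_std_le R hr) _; rewrite lee_fin natrD natrM.
  by have := sqrtr_ge0 (16 * ln 2 * r%:R : R); lra.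
Qed.
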